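(* Let $t\ge 3$ and let $C_t\vee\ell$ be the cycle on $t$ vertices with a leaf attached. Then $$\mathcal{GM}(C_t\vee\ell)\simeq\mathcal{M}(C_t\vee\ell).$$
   Context: $C_t$ ($t\ge3$) is the cycle graph on $t$ vertices, and $C_t\vee\ell$ is the graph obtained from $C_t$ by attaching a leaf $\ell$, i.e. adding one new vertex joined by one new edge to some vertex of $C_t$. For a finite simplicial complex $K$, a discrete vector field on $K$ is a set $V$ of pairs $(\sigma^{(p)},\tau^{(p+1)})$ of simplices of $K$ with $\sigma$ a codimension-one face of $\tau$ (superscripts denote dimension), such that each simplex of $K$ is in at most one pair. A $V$-path is a sequence $\alpha_0^{(p)},\beta_0^{(p+1)},\alpha_1^{(p)},\beta_1^{(p+1)},\ldots,\beta_{k-1}^{(p+1)},\alpha_k^{(p)}$ of simplices with $(\alpha_i,\beta_i)\in V$ and $\beta_i>\alpha_{i+1}\neq\alpha_i$ for $0\le i\le k-1$; it is non-trivial if $k\neq 0$ and closed if $\alpha_k=\alpha_0$. A gradient vector field is a discrete vector field with no non-trivial closed $V$-paths; it is primitive if it consists of a single pair. The Morse complex $\mathcal{M}(K)$ is the simplicial complex whose vertices are the primitive gradient vector fields on $K$ and whose $n$-simplices are the gradient vector fields on $K$ with $n+1$ pairs. The generalized Morse complex $\mathcal{GM}(K)$ is the simplicial complex with the same vertices whose simplices are the nonempty discrete vector fields on $K$. In both, the face relation is inclusion. *)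

(* Defs.v *)
From HB Require Import structures.
From mathcomp Require Import all_boot all_order all_algebra.
From mathcomp Require Import boolp.

Set Implicit Arguments.
Unset Strict Implicit.
Unset Printing Implicit Defensive.

(** * Finite simplicial complexes *)

(* Simplices are nonempty; not every element of [T] has to be a vertex. *)
Record complex (T : finType) := Complex {
  simplices :> {set {set T}};
  simplices_neq0 : set0 \notin simplices;
  simplices_face : forall s u : {set T},
    s \in simplices -> u \subset s -> u != set0 -> u \in simplices }.

(** * Graphs as 1-dimensional complexes *)

Definition graph_simplices (T : finType) (e : rel T) : {set {set T}} :=
  [set s | [exists x, s == [set x]]
        || [exists x, [exists y, e x y && (s == [set x; y])]]]%SET.

Lemma graph_simplices_neq0 (T : finType) (e : rel T) :
  set0 \notin graph_simplices e.
Proof.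
rewrite inE; apply/norP; split; apply/existsPn => x.
  by apply/eqP => /setP/(_ x); rewrite !inE eqxx.
apply/existsPn => y; apply/nandP; right.
by apply/eqP => /setP/(_ x); rewrite !inE eqxx.
Qed.

Lemma graph_simplices_face (T : finType) (e : rel T) (s u : {set T}) :
  s \in graph_simplices e -> u \subset s -> u != set0 ->
  u \in graph_simplices e.
Proof.
rewrite !inE => + us u0; case/orP => [/existsP[x /eqP sx]|].
  move: us; rewrite sx subset1 (negPf u0) orbF => /eqP->.
  by apply/orP; left; apply/existsP; exists x.
move=> /existsP[x /existsP[y /andP[exy /eqP sxy]]].
move: us; rewrite sxy => us.
have [xu|xu] := boolP (x \in u); have [yu|yu] := boolP (y \in u).
- apply/orP; right; apply/existsP; exists x; apply/existsP; exists y.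
  by rewrite exy eqEsubset us; apply/subsetP => z; rewrite !inE => /orP[]/eqP->.
- apply/orP; left; apply/existsP; exists x; rewrite eqEsubset sub1set xu andbT.
  apply/subsetP => z zu; move/subsetP/(_ z zu): us; rewrite !inE.
  by case/orP => // /eqP zy; rewrite -zy zu in yu.
- apply/orP; left; apply/existsP; exists y; rewrite eqEsubset sub1set yu andbT.
  apply/subsetP => z zu; move/subsetP/(_ z zu): us; rewrite !inE.
  by case/orP => // /eqP zx; rewrite -zx zu in xu.
- case/set0Pn: u0 => z zu; move/subsetP/(_ z zu): us; rewrite !inE.
  by case/orP => /eqP zE; rewrite zE in zu; rewrite zu in xu yu.
Qed.

(* [e] is meant to be symmetric and irreflexive. *)
Definition graph_complex (T : finType) (e : rel T) : complex T :=
  Complex (graph_simplices_neq0 e) (@graph_simplices_face T e).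

(* [ordS x] is the successor of [x] modulo [t]. *)
Definition cycle_graph (t : nat) : rel 'I_t :=
  [rel x y | (y == ordS x) || (x == ordS y)].

Definition attach_leaf (T : finType) (e : rel T) (v : T) : rel (option T) :=
  fun x y => match x, y with
  | Some a, Some b => e a b
  | Some a, None => a == v
  | None, Some b => b == v
  | None, None => false
  end.

(** * Discrete vector fields *)

Definition codim1_face (T : finType) (s u : {set T}) : bool :=
  (s \subset u) && (#|u| == #|s|.+1).

Definition is_discrete_vector_field (T : finType) (K : complex T)
    (V : {set {set T} * {set T}}) : bool :=
  [forall p in V, [&& p.1 \in K, p.2 \in K & codim1_face p.1 p.2]] &&
  [forall s : {set T},
     #|[set p in V | (s == p.1) || (s == p.2)]%SET| <= 1]%N.

(* The V-path a_0, b_0, a_1, ..., b_{k-1}, a_k is given by its first simplex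
   [a] = a_0 and the list [w] of the pairs (b_i, a_{i+1}), i < k. *)
Fixpoint is_Vpath (T : finType) (V : {set {set T} * {set T}})
    (a : {set T}) (w : seq ({set T} * {set T})) : bool :=
  match w with
  | [::] => true
  | (b, a') :: w' =>
      [&& (a, b) \in V, codim1_face a' b, a' != a & is_Vpath V a' w']
  end.

Definition Vpath_end (T : finType) (a : {set T})
  (w : seq ({set T} * {set T})) : {set T} := last a (unzip2 w).

Definition is_gradient (T : finType) (K : complex T)
    (V : {set {set T} * {set T}}) : Prop :=
  is_discrete_vector_field K V /\
  forall (a : {set T}) (w : seq ({set T} * {set T})),
    is_Vpath V a w -> w != [::] -> Vpath_end a w != a.

(** * Morse complexes *)

(* A primitive vector field [set p] is identified with its pair p, so that a
   vector field with n+1 pairs is itself the n-simplex spanned by its primitive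
   subfields. *)

Definition generalized_morse_simplices (T : finType) (K : complex T) :
    {set {set {set T} * {set T}}} :=
  [set V | is_discrete_vector_field K V && (V != set0)]%SET.

Definition morse_simplices (T : finType) (K : complex T) :
    {set {set {set T} * {set T}}} :=
  [set V | `[< is_gradient K V >] && (V != set0)]%SET.

Lemma is_discrete_vector_field_sub (T : finType) (K : complex T)
    (V W : {set {set T} * {set T}}) :
  is_discrete_vector_field K V -> W \subset V -> is_discrete_vector_field K W.
Proof.
move=> /andP[/forall_inP VK /forallP V1] WV; apply/andP; split.
  by apply/forall_inP => p pW; apply/VK/(subsetP WV).
apply/forallP => s; apply: leq_trans (V1 s); apply/subset_leq_card.
apply/subsetP => p; rewrite !inE => /andP[pW ->]; rewrite andbT.
exact: (subsetP WV).
Qed.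

Lemma is_Vpath_sub (T : finType) (V W : {set {set T} * {set T}})
    (a : {set T}) (w : seq ({set T} * {set T})) :
  W \subset V -> is_Vpath W a w -> is_Vpath V a w.
Proof.
move=> WV; elim: w a => //= -[b a'] w IH a /and4P[abW -> -> /IH ->].
by rewrite (subsetP WV _ abW).
Qed.

Lemma is_gradient_sub (T : finType) (K : complex T)
    (V W : {set {set T} * {set T}}) :
  is_gradient K V -> W \subset V -> is_gradient K W.
Proof.
move=> [VK Vac] WV; split; first exact: is_discrete_vector_field_sub WV.
by move=> a w /(is_Vpath_sub WV); exact: Vac.
Qed.

Lemma generalized_morse_simplices_neq0 (T : finType) (K : complex T) :
  set0 \notin generalized_morse_simplices K.
Proof. by rewrite inE eqxx andbF. Qed.

Lemma generalized_morse_simplices_face (T : finType) (K : complex T)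
    (V W : {set {set T} * {set T}}) :
  V \in generalized_morse_simplices K -> W \subset V -> W != set0 ->
  W \in generalized_morse_simplices K.
Proof.
rewrite !inE => /andP[VK _] WV ->; rewrite andbT.
exact: is_discrete_vector_field_sub WV.
Qed.

Lemma morse_simplices_neq0 (T : finType) (K : complex T) :
  set0 \notin morse_simplices K.
Proof. by rewrite inE eqxx andbF. Qed.

Lemma morse_simplices_face (T : finType) (K : complex T)
    (V W : {set {set T} * {set T}}) :
  V \in morse_simplices K -> W \subset V -> W != set0 ->
  W \in morse_simplices K.
Proof.
rewrite !inE => /andP[/asboolP VK _] WV ->; rewrite andbT.
by apply/asboolP; exact: is_gradient_sub WV.
Qed.

Definition generalized_morse_complex (T : finType) (K : complex T) :
    complex ({set T} * {set T})%type :=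
  Complex (generalized_morse_simplices_neq0 K)
          (@generalized_morse_simplices_face T K).

Definition morse_complex (T : finType) (K : complex T) :
    complex ({set T} * {set T})%type :=
  Complex (morse_simplices_neq0 K) (@morse_simplices_face T K).

(** * Homotopy type *)

(* Imported only here: [classical_sets] shadows names of [finset]. *)
From mathcomp Require Import all_classical all_reals all_analysis.
Import Order.TTheory GRing.Theory Num.Theory.
Import numFieldNormedType.Exports.

Local Open Scope classical_set_scope.
Local Open Scope ring_scope.

(* The set of barycentric coordinates, in R^T with the product topology. *)
Definition realization (R : realType) (T : finType) (K : complex T) :
    set {ptws T -> R} :=
  [set f | [/\ forall x, 0 <= f x, \sum_x f x = 1
             & finset (fun x => f x != 0) \in simplices K]].
Arguments realization R {T} K.

Definition homotopic (R : realType) (X Y : topologicalType) (f g : X -> Y) :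
    Prop :=
  exists H : R * X -> Y,
    [/\ {within `[0, 1] `*` [set: X], continuous H},
        forall x, H (0, x) = f x & forall x, H (1, x) = g x].

Definition homotopy_equivalent (R : realType) (X Y : topologicalType) : Prop :=
  exists (f : X -> Y) (g : Y -> X),
    [/\ continuous f, continuous g,
        homotopic R (g \o f) id & homotopic R (f \o g) id].

(* The realizations carry the subspace topology. *)
Definition complex_homotopy_equivalent (R : realType) (S T : finType)
    (K : complex S) (L : complex T) : Prop :=
  homotopy_equivalent R (realization R K : Type) (realization R L : Type).

(* Main.v *)
Require Import Defs.
From mathcomp Require Import all_boot all_order all_algebra.
From mathcomp Require Import all_classical all_reals all_analysis.
From mathcomp Require Import fintype finset.

(** A discrete vector field on a graph is a set of arrows x -> y, one for each
    pair ({x}, {x, y}) of a vertex and an incident edge; no two arrows leave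
    the same vertex or share an edge. A closed V-path is then a closed walk
    along the arrows that never turns back, so it runs around a cycle of the
    graph. In the cycle with a leaf there is a single cycle, with two
    orientations. Hence a vector field fails to be a gradient exactly when it
    contains one of the two rotations, the fields A and B whose arrows turn
    every vertex of the cycle in the same direction
    ([not_gradient_rotation], [rotation_not_gradient]).

    A rotation already uses all vertices and edges of the cycle; only the arrow
    p from the leaf to the cycle can be added to it, and it can be
    ([vector_field_over_rotation], [rotation_leaf_vector_field]). So the
    generalized Morse complex has just the four simplices A, A + p, B and B + p
    in excess of the Morse complex. As A is a free face of A + p, and B of
    B + p, removing these pairs is an elementary collapse
    ([collapse_equivalence]).

    On realizations the collapse is explicit. With |A| the number of vertices
    of the simplex A, subtract from each coordinate in A the minimum m of these
    coordinates and add |A| m to the coordinate p. This map is continuous, is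
    the identity where m = 0, and moves each point along a segment inside a
    single simplex, so a straight-line homotopy finishes the argument
    ([straight_line_equivalence]). Performing both collapses by one formula
    leaves no homotopies to compose. *)

Set Implicit Arguments.
Unset Strict Implicit.
Unset Printing Implicit Defensive.

Import Order.TTheory GRing.Theory Num.Theory.
Import numFieldNormedType.Exports.

Local Open Scope ring_scope.

(** * Straight-line homotopies on realizations *)

Section Realization.
Variables (R : realType) (T : finType).
Implicit Types (K L : complex T) (f : T -> R).

Definition supp f : {set T} := finset (fun x => f x != 0).

Lemma coordinate_continuous K (x : T) :
  continuous (fun f : realization R K => set_val f x : R).
Proof.
move=> f; apply: (@continuous_comp _ {ptws T -> R} _ set_val (@^~ x)).
  exact: initial_continuous.
exact: (@proj_continuous T (fun=> R) x).
Qed.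

Lemma continuous_into_realization (X : topologicalType) K
    (g : X -> realization R K) :
  (forall x, continuous (fun z => set_val (g z) x : R)) -> continuous g.
Proof.
move=> gc; suff h : continuous (fun z => set_val (g z) : {ptws T -> R}).
  apply/continuousP => A [B oB <-].
  by move/continuousP : h => /(_ B oB).
move=> z; apply/cvg_sup => x A [B [[C oC <-] Cz] sBA].
have nC : nbhs (set_val (g z) x : R) C by exact: open_nbhs_nbhs.
apply: (@filterS _ _ _ (fun y => C (set_val (g y) x))) (gc x z _ nC).
by move=> y Cy; exact: sBA.
Qed.

(** The segment from f to rho f stays in the realization of K because its
    points are supported in the union of the supports of the two ends. *)
Lemma straight_line_equivalence K L (rho : (T -> R) -> (T -> R)) :
  simplices L \subset simplices K ->
  (forall x, continuous (fun f : realization R K => rho (set_val f) x : R)) ->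
  (forall f, realization R K f -> realization R L (rho f)) ->
  (forall f, realization R L f -> rho f = f) ->
  (forall f, realization R K f -> supp f :|: supp (rho f) \in simplices K) ->
  complex_homotopy_equivalent R K L.
Proof.
move=> LK rhoc rhoL rhoid carrier.
have incP f : realization R L f -> realization R K f.
  by case=> f0 f1 fL; split=> //; exact: (subsetP LK).
have pointP K' (f : realization R K') : realization R K' (set_val f).
  exact: set_valP.
pose r (f : realization R K) : realization R L :=
  SigSub (mem_set (rhoL _ (pointP _ f))).
pose i (f : realization R L) : realization R K :=
  SigSub (mem_set (incP _ (pointP _ f))).
(* The homotopy must be defined at every real time and take its values in the
   realization, so the time is clamped to the unit interval. *)
pose clamp (s : R) : R := Num.max 0 (Num.min s 1).
have clamp01 s : 0 <= clamp s <= 1.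
  rewrite /clamp le_max lexx /= ge_max ler01 /=.
  by rewrite ge_min lexx orbT.
pose h s f := fun x => (1 - clamp s) * f x + clamp s * rho f x.
have hK s f : realization R K f -> realization R K (h s f).
  move=> fK; have [f0 f1 _] := fK; have [rf0 rf1 _] := rhoL _ fK.
  have /andP[s0 s1] := clamp01 s; split.
  - by move=> x; rewrite addr_ge0 ?mulr_ge0 ?subr_ge0.
  - by rewrite big_split /= -!mulr_sumr f1 rf1 !mulr1 subrK.
  - have hsub : supp (h s f) \subset supp f :|: supp (rho f).
      apply/subsetP => x; rewrite !inE -negb_and; apply: contra.
      by rewrite /h => /andP[/eqP-> /eqP->]; rewrite !mulr0 addr0.
    apply: simplices_face (carrier _ fK) hsub _.
    apply/eqP => h0; have : \sum_x h s f x = 0.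
      apply: big1 => x _; apply/eqP; have /setP/(_ x) := h0.
      by rewrite !inE => /negbFE.
    rewrite big_split /= -!mulr_sumr f1 rf1 !mulr1 subrK => /eqP.
    by rewrite oner_eq0.
exists r, i; split.
- apply: continuous_into_realization => x; exact: rhoc.
- apply: continuous_into_realization => x; exact: coordinate_continuous.
- (* [h] runs from the identity to rho, so time is reversed. *)
  exists (fun sf : R * realization R K =>
    SigSub (mem_set (hK (1 - sf.1) _ (pointP _ sf.2))) : realization R K); split.
  + apply: continuous_subspaceT; apply: continuous_into_realization => x [s f].
    have cc : {for (s, f), continuous
        (fun z : R * realization R K => clamp (1 - z.1) : R^o)}.
      apply: (@continuous_max R _ (cst 0)); first exact: cst_continuous.
      apply: (@continuous_min R _ _ (cst 1)); last exact: cst_continuous.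
      apply: cvgB; [exact: cvg_cst|exact: cvg_fst].
    apply: cvgD; apply: (@cvgM R).
    * by apply: cvgB; [exact: cvg_cst|exact: cc].
    * apply: (@continuous_comp _ _ _ snd
        (fun f : realization R K => set_val f x : R)).
        exact: cvg_snd.
      exact: coordinate_continuous.
    * exact: cc.
    * apply: (@continuous_comp _ _ _ snd
        (fun f : realization R K => rho (set_val f) x : R)).
        exact: cvg_snd.
      exact: rhoc.
  + move=> f; apply/val_inj/funext => x /=.
    rewrite /h /clamp subr0 minxx (max_idPr _) ?ler01 //.
    by rewrite subrr mul0r add0r mul1r.
  + move=> f; apply/val_inj/funext => x /=.
    rewrite /h /clamp subrr (min_idPl _) ?ler01 // maxxx.
    by rewrite subr0 mul0r addr0 mul1r.
- exists snd; split.
  + by apply: continuous_subspaceT => -[s f]; exact: cvg_snd.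
  + move=> f; apply/val_inj => /=; rewrite rhoid //; exact: pointP.
  + by [].
Qed.

End Realization.

(** * Collapsing free faces with a common apex *)

Section Collapse.
Variables (R : realType) (T : finType).
Implicit Types (f : T -> R) (s : {set T}).

(** The default value 1 bounds all barycentric coordinates, so it does not
    change the minimum over a nonempty set. *)
Definition min_on s f : R := \big[Num.min/1]_(y in s) f y.

(** For each s in S, this moves the mass [min_on s f] from every vertex of s to
    the apex x; for a point whose support contains no member of S nothing
    moves. *)
Definition collapse_map (S : {set {set T}}) (x : T) f : T -> R := fun y =>
  f y + \sum_(s in S) min_on s f * (#|s|%:R * (y == x)%:R - (y \in s)%:R).

Lemma min_on_le s f y : y \in s -> min_on s f <= f y.
Proof. exact: bigmin_le_cond. Qed.

Lemma min_on_eq0 s f : (forall y, 0 <= f y) ->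
  ~~ (s \subset supp f) -> min_on s f = 0.
Proof.
move=> f0 /subsetPn[y ys]; rewrite inE negbK => /eqP fy.
apply/le_anti; rewrite -{1}fy min_on_le //=.
by apply/bigmin_geP; split=> // z _.
Qed.

Lemma min_on_attained s f : (forall y, f y <= 1) -> s != set0 ->
  exists2 y, y \in s & min_on s f = f y.
Proof.
move=> f1 /set0Pn[y ys].
have [z zs sz] := @eq_bigmin _ _ _ 1 y (mem s) f ys (fun z _ => f1 z).
by exists z.
Qed.

Lemma coordinate_le1 (K : complex T) f :
  realization R K f -> forall y, f y <= 1.
Proof.
case=> f0 f1 _ y; rewrite -f1 (bigD1 y) //= lerDl.
by apply: sumr_ge0 => z _.
Qed.

Lemma collapse_map_continuous (K : complex T) S x y :
  continuous (fun f : realization R K => collapse_map S x (set_val f) y : R).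
Proof.
have minc s : continuous (fun f : realization R K => min_on s (set_val f) : R).
  apply: (@continuous_big R _ Num.min 1 (mem s) _ _ _
    (fun y (f : realization R K) => set_val f y)); last first.
    move=> z _; exact (@coordinate_continuous R T K z).
  move=> z.
  by apply: (@continuous_min R _ fst snd); [exact: cvg_fst|exact: cvg_snd].
move=> f; apply: cvgD; [exact: nbhs_filter|exact: coordinate_continuous|].
apply: cvg_big => [||s _]; [exact: add_continuous|exact: nbhs_filter|].
apply: cvgM; [exact: nbhs_filter|exact (minc s f)|].
apply: cvg_cst; exact: nbhs_filter.
Qed.

Lemma collapse_map_id (S : {set {set T}}) x f : (forall y, 0 <= f y) ->
  (forall s, s \in S -> ~~ (s \subset supp f)) -> collapse_map S x f = f.
Proof.
move=> f0 Sf; apply/funext => y; rewrite /collapse_map big1 ?addr0 // => s sS.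
by rewrite min_on_eq0 ?mul0r // Sf.
Qed.

(** Several elementary collapses of pairs (s, x |: s) at once. The supports of
    points that move are s or x |: s; as the members of S are incomparable and
    avoid x, each moving point is moved by a single s, and then a vertex of s
    where the minimum is attained gets coordinate 0, so the image leaves the
    free face s. *)
Lemma collapse_equivalence (K L : complex T) (S : {set {set T}}) (x : T) :
  set0 \notin S ->
  (forall s, s \in S -> x \notin s) ->
  {in S &, forall s s' : {set T}, s \subset s' -> s = s'} ->
  (forall s, s \in S -> (x |: s)%SET \in simplices K) ->
  (forall s u : {set T}, s \in S -> u \in simplices K -> s \subset u ->
     u \subset (x |: s)%SET) ->
  (forall u, (u \in simplices L) =
     (u \in simplices K) && [forall s in S, ~~ (s \subset u)]) ->
  complex_homotopy_equivalent R K L.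
Proof.
move=> S0 xS anti xsK free LE.
(* At a point whose support contains s, only the term of s remains. *)
have local f s : realization R K f -> s \in S -> s \subset supp f ->
    forall y, collapse_map S x f y =
      f y + min_on s f * (#|s|%:R * (y == x)%:R - (y \in s)%:R).
  move=> [f0 f1 fK] sS sf y; rewrite /collapse_map (bigD1 s) //= big1 ?addr0 //.
  move=> s' /andP[s'S s's]; rewrite min_on_eq0 ?mul0r //.
  apply: contra s's => s'f; apply/eqP/anti => //.
  have s'xs := subset_trans s'f (free _ _ sS fK sf).
  apply/subsetP => z zs'; move/subsetP/(_ z zs') : s'xs.
  by rewrite !inE => /orP[/eqP zx|//]; have := xS _ s'S; rewrite -zx zs'.
have supp_local f s : realization R K f -> s \in S -> s \subset supp f ->
    supp (collapse_map S x f) \subset (x |: s)%SET.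
  move=> fK sS sf; have [f0 f1 fK'] := fK; apply/subsetP => y.
  rewrite inE (local f s) //; apply: contraR => yxs.
  have yf : f y = 0.
    apply/eqP; apply: contraR yxs => yf.
    by apply: (subsetP (free _ _ sS fK' sf)); rewrite inE.
  move: yxs; rewrite !inE negb_or => /andP[/negPf-> /negPf->].
  by rewrite yf mulr0 subrr mulr0 addr0.
have away f : realization R K f -> (exists2 s, s \in S & s \subset supp f) \/
    (realization R L f /\ collapse_map S x f = f).
  case=> f0 f1 fK.
  have [/exists_inP[s sS sf]|/exists_inPn Sf] :=
    boolP [exists s in S, s \subset supp f]; first by left; exists s.
  right; split; last exact: collapse_map_id.
  by split=> //; rewrite LE fK; exact/forall_inP.
apply: (@straight_line_equivalence R T K L (collapse_map S x)).
- by apply/subsetP => u; rewrite LE => /andP[].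
- move=> y; exact: collapse_map_continuous.
- move=> f fK; have [[s sS sf]|[fL ->//]] := away f fK.
  have [f0 f1 fK'] := fK.
  have m0 : 0 <= min_on s f by apply/bigmin_geP; split=> // z _.
  have sum1 : \sum_y collapse_map S x f y = 1.
    under eq_bigr do rewrite (local f s) //.
    rewrite big_split /= f1 -mulr_sumr sumrB -mulr_sumr.
    rewrite -(natr_sum _ _ _ (fun y => nat_of_bool (y == x))).
    rewrite -(natr_sum _ _ _ (fun y => nat_of_bool (y \in s))).
    by rewrite -!big_mkcond /= !sum1_card card1 mulr1 subrr mulr0 addr0.
  split=> // [y|].
    rewrite (local f s) //; have [->|yx] := eqVneq y x.
      by rewrite (negPf (xS _ sS)) subr0 mulr1 addr_ge0 ?mulr_ge0.
    rewrite mulr0 sub0r mulrN subr_ge0; have [ys|ys] := boolP (y \in s).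
      by rewrite mulr1 min_on_le.
    by rewrite mulr0.
  rewrite LE; apply/andP; split.
    apply: simplices_face (xsK _ sS) (supp_local f s fK sS sf) _.
    apply/eqP => h0; move/eqP: sum1; rewrite big1 1?eq_sym ?oner_eq0 //.
    by move=> y _; apply/eqP; have /setP/(_ y) := h0; rewrite !inE => /negbFE.
  apply/forall_inP => s' s'S; apply/negP => s'r.
  have ss' : s' = s.
    apply: anti => //; apply/subsetP => z zs'.
    have := subsetP (subset_trans s'r (supp_local f s fK sS sf)) z zs'.
    by rewrite !inE => /orP[/eqP zx|//]; have := xS _ s'S; rewrite -zx zs'.
  rewrite {s'}ss' in s'S s'r.
  have [|y ys my] := min_on_attained (coordinate_le1 fK) (s := s).
    by apply: contraNneq S0 => <-.
  have := subsetP s'r y ys; rewrite inE (local f s) // my ys.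
  have /negPf-> : y != x by apply: contraNneq (xS _ sS) => <-.
  by rewrite mulr0 sub0r mulrN mulr1 subrr eqxx.
- move=> f [f0 f1]; rewrite LE => /andP[fK /forall_inP Sf].
  exact: collapse_map_id.
- move=> f fK; have [f0 f1 fK'] := fK.
  have [[s sS sf]|[_ ->]] := away f fK; last by rewrite setUid.
  apply: simplices_face (xsK _ sS) _ _.
    by rewrite subUset (free _ _ sS fK' sf) supp_local.
  apply: contraNneq (simplices_neq0 K) => f00.
  suff -> : set0 = supp f by [].
  by apply/esym/eqP; rewrite -subset0 -f00 subsetUl.
Qed.

End Collapse.

(** * Vector fields on graphs *)

Local Open Scope set_scope.

Lemma set2_injr (T : finType) (x y z : T) : [set x; y] = [set x; z] -> y = z.
Proof.
move=> E; have /set2P[yx|//] : y \in [set x; z] by rewrite -E set22.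
have /set2P[->//|->//] : z \in [set x; y] by rewrite E set22.
Qed.

Section GraphVectorFields.
Variables (T : finType) (e : rel T).
Hypotheses (e_sym : symmetric e) (e_irr : irreflexive e).
Implicit Types (V : {set {set T} * {set T}}) (p q : {set T} * {set T}).

Definition arrow (x y : T) : {set T} * {set T} := ([set x], [set x; y]).

Lemma edge_card2 x y : e x y -> #|[set x; y]| = 2.
Proof. by rewrite cards2; have [->|//] := eqVneq x y; rewrite e_irr. Qed.

Lemma arrowP p : reflect (exists x y, e x y /\ p = arrow x y)
  [&& p.1 \in graph_complex e, p.2 \in graph_complex e & codim1_face p.1 p.2].
Proof.
apply: (iffP and3P) => [|[x [y [exy ->]]]]; last first.
  rewrite /codim1_face /= edge_card2 // cards1 eqxx andbT sub1set set21.
  split=> //; rewrite inE; apply/orP; [left|right].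
    by apply/existsP; exists x.
  by apply/existsP; exists x; apply/existsP; exists y; rewrite exy eqxx.
case: p => a b /= [aK bK /andP[ab /eqP cab]].
have a0 : a != set0 by apply: contraTneq aK => ->; exact: graph_simplices_neq0.
move: bK; rewrite inE => /orP[/existsP[x /eqP bx]|].
  by move: a0; rewrite -cards_eq0; move: cab; rewrite bx cards1 => -[<-].
move=> /existsP[x /existsP[y /andP[exy /eqP bxy]]].
move: cab; rewrite bxy edge_card2 // => -[/esym/eqP/cards1P[z az]].
move: ab; rewrite bxy az sub1set => /set2P[]->.
  by exists x, y.
by exists y, x; rewrite e_sym /arrow setUC.
Qed.

Lemma field_uniq V (u : {set T}) p q :
  is_discrete_vector_field (graph_complex e) V -> p \in V -> q \in V ->
  (u == p.1) || (u == p.2) -> (u == q.1) || (u == q.2) -> p = q.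
Proof.
move=> /andP[_ /forallP/(_ u)/card_le1_eqP V1] pV qV up uq.
by apply: V1; rewrite inE ?pV ?qV.
Qed.

Lemma field_arrow V p : is_discrete_vector_field (graph_complex e) V ->
  p \in V -> exists x y, e x y /\ p = arrow x y.
Proof. by move=> /andP[/forall_inP VK _] /VK/arrowP. Qed.

Lemma field_no_return V x y : is_discrete_vector_field (graph_complex e) V ->
  arrow x y \in V -> arrow y x \in V -> x = y.
Proof.
move=> VK xy yx.
have E : arrow x y = arrow y x.
  apply: (field_uniq (u := [set x; y]) VK xy yx); first by rewrite eqxx orbT.
  by rewrite /= [[set y; x]]setUC eqxx orbT.
by have /set1_inj := congr1 fst E.
Qed.

Definition flow (g : T -> T) : {set {set T} * {set T}} :=
  [set arrow x (g x) | x : T].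

(** Two arrows of the graph of a function can only meet in a common edge, and
    then they are x -> g x and g x -> x, which forces g (g x) = x. *)
Lemma flow_vector_field (g : T -> T) :
  (forall x, e x (g x)) -> (forall x, g (g x) != x) ->
  is_discrete_vector_field (graph_complex e) (flow g).
Proof.
move=> eg gg; apply/andP; split.
  by apply/forall_inP => p /imsetP[x _ ->]; apply/arrowP; exists x, (g x).
apply/forallP => u; apply/card_le1_eqP => p q; rewrite !inE.
move=> /andP[/imsetP[x _ ->] ux] /andP[/imsetP[y _ ->] uy].
suff -> : x = y by [].
have c2 z : #|[set z; g z]| = 2 by apply: edge_card2.
move: ux uy => /= /orP[/eqP->|/eqP->] /orP[/eqP|/eqP E].
- exact: set1_inj.
- by move/(congr1 (fun a : {set T} => #|a|)) : E; rewrite c2 cards1.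
- by move/(congr1 (fun a : {set T} => #|a|)); rewrite c2 cards1.
have /set2P[//|xg] : x \in [set y; g y] by rewrite -E set21.
have /set2P[//|yg] : y \in [set x; g x] by rewrite E set21.
by have := gg x; rewrite -yg -xg eqxx.
Qed.

(** Take for P the vertices visited by a closed V-path: from each of them an
    arrow leads to the next one. Passing to this set replaces the bookkeeping of
    positions in the path by a closure property. *)
Lemma not_gradient_walk V :
  is_discrete_vector_field (graph_complex e) V ->
  ~ is_gradient (graph_complex e) V ->
  exists2 P : {set T}, P != set0 &
    {in P, forall x, exists2 y, y \in P & e x y /\ arrow x y \in V}.
Proof.
move=> VK nV.
have [a [w [aw w0 closed]]] : exists a w,
    [/\ is_Vpath V a w, w != [::] & Vpath_end a w = a].
  apply: contrapT => nex; apply: nV; split=> // a w aw w0.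
  by apply/eqP => closed; apply: nex; exists a, w.
(* Without its edges, a closed V-path is a cycle for the relation [step], in
   which every simplex has a successor. *)
pose step (a a' : {set T}) :=
  [exists b, [&& (a, b) \in V, codim1_face a' b & a' != a]].
have step_arrow a1 a2 : step a1 a2 -> exists x y,
    [/\ a1 = [set x], a2 = [set y], e x y & arrow x y \in V].
  move=> /existsP[b /and3P[abV /andP[a2b /eqP ca2] a21]].
  have [x [y [exy [a1x bxy]]]] := field_arrow VK abV; exists x, y.
  split=> //; last by rewrite /arrow -bxy -a1x.
  move: ca2; rewrite bxy edge_card2 // => -[/esym/eqP/cards1P[z a2z]].
  move: a21 a2b; rewrite a2z a1x bxy sub1set => zx /set2P[zE|->//].
  by rewrite zE eqxx in zx.
have cyc : cycle step (unzip2 w).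
  rewrite (cycle_path a) -/(Vpath_end a w) closed.
  elim: w a aw {w0 closed} => //= -[b a'] w IH a /= /and4P[abV a'b a'a /IH ->].
  by rewrite andbT; apply/existsP; exists b; apply/and3P.
exists [set x | [set x] \in unzip2 w].
  case: w w0 cyc {aw closed} => [//|[b a1] w] _ cyc.
  have a1w : a1 \in unzip2 ((b, a1) :: w) by rewrite mem_head.
  have [x [y [a1x _ _ _]]] := step_arrow _ _ (next_cycle cyc a1w).
  by apply/set0Pn; exists x; rewrite inE -a1x.
move=> x; rewrite inE => xw.
have [z [y [/set1_inj<- ny exy xyV]]] := step_arrow _ _ (next_cycle cyc xw).
by exists y; first by rewrite inE -ny mem_next.
Qed.

End GraphVectorFields.

(** * The cycle with a leaf *)

Section LeafedCycle.
Variable I : finType.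
Implicit Types (e : rel I) (s : I -> I).
Implicit Types (V : {set {set option I} * {set option I}}).

Lemma attach_leaf_sym e v : symmetric e -> symmetric (attach_leaf e v).
Proof. by move=> e_sym [x|] [y|] //=; exact: e_sym. Qed.

Lemma attach_leaf_irr e v : irreflexive e -> irreflexive (attach_leaf e v).
Proof. by move=> e_irr [x|] /=. Qed.

Definition rotation s : {set {set option I} * {set option I}} :=
  [set arrow (Some i) (Some (s i)) | i : I].

Definition leaf_pair (v : I) : {set option I} * {set option I} :=
  arrow None (Some v).

(** The graph e is a cycle, and s and s' are its two orientations. The condition
    s i != s' i excludes cycles of length 1 and 2. The roles of s and s' can be
    exchanged, so that each fact about s holds for both directions. *)
Definition rotations_of e s s' : Prop :=
  [/\ cancel s s', cancel s' s, forall i, s i != s' i,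
      forall i j, fconnect s i j &
      forall i j, e i j = (j == s i) || (j == s' i)].

Lemma rotations_ofC e s s' : rotations_of e s s' -> rotations_of e s' s.
Proof.
move=> [sK s'K ss' str eE]; split=> // [i|i j|i j].
- by rewrite eq_sym.
- have back n : fconnect s' (iter n s j) j.
    elim: n => [|n IH]; first exact: connect0.
    by apply: connect_trans (fconnect1 _ _) _; rewrite iterS sK.
  by have := back (findex s j i); rewrite iter_findex.
- by rewrite eE orbC.
Qed.

Section Rotation.
Variables (e : rel I) (s s' : I -> I) (v : I).
Hypothesis ess' : rotations_of e s s'.
Let G := attach_leaf e v.

Lemma no_fixpoint i : s i != i.
Proof.
have [sK _ ss' _ _] := ess'; apply: contraNneq (ss' i) => si.
by rewrite -{2}si sK si.
Qed.

Lemma no_two_cycle i : s (s i) != i.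
Proof.
have [sK _ ss' _ _] := ess'; apply: contraNneq (ss' (s i)) => ssi.
by rewrite ssi sK.
Qed.

Lemma leafed_sym : symmetric G.
Proof.
have [sK s'K _ _ eE] := ess'; apply: attach_leaf_sym => i j.
by rewrite !eE -(can2_eq s'K sK) -(can2_eq sK s'K) orbC !(eq_sym i).
Qed.

Lemma leafed_irr : irreflexive G.
Proof.
have [sK s'K _ _ eE] := ess'; apply: attach_leaf_irr => i.
by rewrite eE -(can2_eq sK s'K) eq_sym orbb (negPf (no_fixpoint _)).
Qed.

Lemma rotation_not_gradient V :
  rotation s \subset V -> ~ is_gradient (graph_complex G) V.
Proof.
move=> sV [_ acyclic].
pose walk n i :=
  [seq ([set Some j; Some (s j)], [set Some (s j)]) | j <- traject s i n].
have walkP n i : is_Vpath V [set Some i] (walk n i).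
  elim: n i => //= n IH i; rewrite IH andbT; apply/and3P; split.
  - by apply: (subsetP sV); apply: imset_f.
  - rewrite /codim1_face cards1 cards2 sub1set set22 /=.
    by rewrite (inj_eq Some_inj) [i == _]eq_sym no_fixpoint.
  - by apply: contra (no_fixpoint i) => /eqP/set1_inj[->].
have walk_end n i : Vpath_end [set Some i] (walk n i) = [set Some (iter n s i)].
  by elim: n i => //= n IH i; rewrite -iterS iterSr -IH.
have [sK _ _ _ _] := ess'.
have := acyclic _ _ (walkP (order s v) v).
rewrite walk_end iter_order; last exact: can_inj sK.
by rewrite -orderSpred eqxx => /(_ isT).
Qed.

(** A walk that has started in direction s cannot turn back, as the two arrows
    would share an edge; so it goes all the way around. *)
Lemma walk_rotates V (P : {set option I}) i :
  is_discrete_vector_field (graph_complex G) V ->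
  (forall i, Some i \in P -> exists2 j, Some j \in P &
     e i j /\ arrow (Some i) (Some j) \in V) ->
  arrow (Some i) (Some (s i)) \in V -> Some (s i) \in P -> rotation s \subset V.
Proof.
move=> VK Pstep iV iP; have [sK s'K _ str eE] := ess'.
have all_n n : arrow (Some (iter n s i)) (Some (iter n.+1 s i)) \in V /\
    Some (iter n.+1 s i) \in P.
  elim: n => [|n [IHV IHP]] //; have [j jP [eij jV]] := Pstep _ IHP.
  move: eij jP jV; rewrite eE => /orP[/eqP->//|/eqP->] _.
  rewrite {2}iterS sK => back.
  have [] := field_no_return VK IHV back.
  by move/esym/eqP; rewrite iterS (negPf (no_fixpoint _)).
apply/subsetP => _ /imsetP[j _ ->]; have <- := iter_findex (str i j).
by rewrite -iterS; case: (all_n (findex s i j)).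
Qed.

Lemma vector_field_over_rotation V :
  is_discrete_vector_field (graph_complex G) V -> rotation s \subset V ->
  V \subset (leaf_pair v |: rotation s).
Proof.
move=> VK sV; apply/subsetP => p pV.
have [x [y [xy pE]]] := field_arrow leafed_sym leafed_irr VK pV.
rewrite inE; apply/orP; case: x xy pE => [i|] xy pE; [right|left].
  have iV : arrow (Some i) (Some (s i)) \in rotation s by apply: imset_f.
  have -> // : p = arrow (Some i) (Some (s i)).
  by apply: (field_uniq (u := [set Some i]) VK pV (subsetP sV _ iV));
    rewrite ?pE /= eqxx.
by case: y xy pE => [j|] //= /eqP-> ->; rewrite inE.
Qed.

Lemma rotation_leaf_vector_field :
  is_discrete_vector_field (graph_complex G) (leaf_pair v |: rotation s).
Proof.
have [_ _ _ _ eE] := ess'.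
pose g x := if x is Some i then Some (s i) else Some v.
apply: is_discrete_vector_field_sub
  (flow_vector_field leafed_sym leafed_irr (g := g) _ _) _.
- by case=> [i|] /=; rewrite ?eE eqxx.
- by case=> [i|] //=; rewrite (inj_eq Some_inj) no_two_cycle.
- apply/subsetP => p; rewrite inE.
  move=> /orP[/set1P->|/imsetP[i _ ->]]; apply/imsetP.
    by exists None.
  by exists (Some i).
Qed.

Lemma rotation_not_sub : rotation s \subset rotation s' -> False.
Proof.
have [_ _ ss' _ _] := ess'.
move=> /subsetP/(_ _ (imset_f _ (erefl : v \in I))).
move=> /imsetP[i _ [/set1_inj[<-] /set2_injr[/eqP]]].
by rewrite (negPf (ss' v)).
Qed.

End Rotation.

Lemma leaf_pair_notin_rotation s v : leaf_pair v \notin rotation s.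
Proof. by apply/imsetP => -[i _ [/set1_inj]]. Qed.

(** A closed walk never enters the leaf, since it could only leave it along the
    same edge; hence it stays on the cycle, where its first arrow decides the
    direction. *)
Lemma not_gradient_rotation e s s' v V :
  rotations_of e s s' ->
  is_discrete_vector_field (graph_complex (attach_leaf e v)) V ->
  ~ is_gradient (graph_complex (attach_leaf e v)) V ->
  (rotation s \subset V) \/ (rotation s' \subset V).
Proof.
move=> ess' VK nV; have [_ _ _ _ eE] := ess'.
have Gs := leafed_sym v ess'; have Gi := leafed_irr v ess'.
have [P /set0Pn[x xP] Pstep] := not_gradient_walk Gs Gi VK nV.
have to_leaf i : arrow (Some i) None \in V -> None \notin P.
  move=> iV; apply/negP => /Pstep[[j|] _ [] //= /eqP jv jV].
  have := field_arrow Gs Gi VK iV => -[a [b [ab E]]].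
  have iv : i = v.
    move: ab; case: E => /set1_inj<- /set2_injr <- /= /eqP //.
  by have := field_no_return VK iV; rewrite iv -{1}jv => /(_ jV).
have Cstep i : Some i \in P -> exists2 j, Some j \in P &
    e i j /\ arrow (Some i) (Some j) \in V.
  move=> /Pstep[[j|] jP [ij ijV]]; first by exists j.
  by have := to_leaf _ ijV; rewrite jP.
have [i iP] : exists i, Some i \in P.
  case: x xP => [i|] xP; first by exists i.
  by have [[j|] jP [//]] := Pstep _ xP; exists j.
have [j jP [ij ijV]] := Cstep _ iP.
move: ij ijV jP; rewrite eE => /orP[]/eqP-> ijV jP; [left|right].
  exact (walk_rotates ess' VK Cstep ijV jP).
exact (walk_rotates (rotations_ofC ess') VK Cstep ijV jP).
Qed.

End LeafedCycle.

Lemma cycle_graph_rotations t : (3 <= t)%N ->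
  rotations_of (@cycle_graph t) (@ordS t) (@ord_pred t).
Proof.
move=> t3; split;
  [exact: ordSK|exact: ord_predK|move=> i|move=> i j|move=> i j].
- apply/eqP => /(congr1 (@ordS t)); rewrite ord_predK => /(congr1 val) /= ssi.
  have i2 : ((i + 2) %% t = i)%N.
    by rewrite -[RHS]ssi -(addn1 (_ %% _)) modnDml addn1 addn2.
  (* If the two neighbours of i agree, then t divides 2. *)
  have : (i + 2 == i + 0 %[mod t])%N by rewrite i2 addn0 modn_small.
  by rewrite eqn_modDl mod0n modn_small.
- have iterE n : iter n (@ordS t) i = ((i + n) %% t)%N :> nat.
    elim: n => [|n IH]; first by rewrite addn0 modn_small.
    by rewrite iterS /= IH -addn1 modnDml -addnA addn1.
  suff -> : j = iter (j + (t - i))%N (@ordS t) i by exact: fconnect_iter.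
  apply: val_inj; rewrite /= iterE addnCA subnKC ?modnDr ?modn_small //.
  exact: ltnW.
- rewrite /cycle_graph /= [i == ordS j]eq_sym.
  by rewrite (can2_eq (@ordSK t) (@ord_predK t)).
Qed.

Theorem corollary22 (R : realType) (t : nat) (ht : (3 <= t)%N) (v : 'I_t) :
  complex_homotopy_equivalent R
    (generalized_morse_complex (graph_complex (attach_leaf (@cycle_graph t) v)))
    (morse_complex (graph_complex (attach_leaf (@cycle_graph t) v))).
Proof.
pose s := @ordS t; pose s' := @ord_pred t.
have rot : rotations_of (@cycle_graph t) s s' := cycle_graph_rotations ht.
have rot' := rotations_ofC rot.
have nonempty (u : 'I_t -> 'I_t) : rotation u != set0.
  by apply/set0Pn; exists (arrow (Some v) (Some (u v))); apply: imset_f.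
apply: (@collapse_equivalence R _ _ _
  [set rotation s; rotation s'] (leaf_pair v)).
- apply/negP => /set2P[]; apply/eqP; by rewrite eq_sym.
- move=> _ /set2P[]->; exact: leaf_pair_notin_rotation.
- move=> _ _ /set2P[]-> /set2P[]-> //.
    by move=> /(rotation_not_sub v rot).
  by move=> /(rotation_not_sub v rot').
- have leafed (u : 'I_t -> 'I_t) : leaf_pair v |: rotation u != set0.
    by apply/set0Pn; exists (leaf_pair v); rewrite setU11.
  move=> _ /set2P[]->; rewrite inE leafed andbT.
    exact: (rotation_leaf_vector_field v rot).
  exact: (rotation_leaf_vector_field v rot').
- move=> _ V /set2P[]->; rewrite inE => /andP[VK _].
    exact: (vector_field_over_rotation rot).
  exact: (vector_field_over_rotation rot').
- move=> V; rewrite !inE; apply/andP/andP=> [[/asboolP gV V0]|].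
    split; first by rewrite V0 gV.1.
    apply/forall_inP => _ /set2P[]->; apply/negP => sV.
      exact: (rotation_not_gradient rot sV gV).
    exact: (rotation_not_gradient rot' sV gV).
  move=> [/andP[VK V0] /forall_inP nsV]; split=> //; apply/asboolP.
  apply: contrapT => /(not_gradient_rotation rot VK)[]; apply/negP/nsV.
    exact: set21.
  exact: set22.
Qed.
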